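(* Assume that the coefficients $f,a$, the initial condition $X_0$ of the Itô diffusion $X$, and the sufficient statistics $c_1,\dots,c_n$ of the exponential family $\mathrm{EF}(c)$ satisfy assumptions (A), (B), (C), (E), (F) listed in the context. Then the projection onto $\mathrm{EF}(c)$ of the Fokker-Planck equation describing the evolution of the density $p_t$ of $X_t$, i.e. the evolution equation $$\frac{d}{dt}\log p(\cdot,\theta_t)=\Pi_{\theta_t}\!\left[\frac{\mathcal L_t^*p(\cdot,\theta_t)}{p(\cdot,\theta_t)}\right]$$ for a curve $t\mapsto p(\cdot,\theta_t)\in\mathrm{EF}(c)$, reads $$[c(\cdot)-E_{\theta_t}c]^T\,\dot\theta_t=E_{\theta_t}[\mathcal L_tc]^T\,g^{-1}(\theta_t)\,[c(\cdot)-E_{\theta_t}c],$$ and the differential equation describing the evolution of the parameters of the projected density evolution is $$\dot\theta_t=g^{-1}(\theta_t)\,E_{\theta_t}[\mathcal L_tc].$$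
   Context: Diffusion. $X$ solves the Itô SDE $dX_t=f_t(X_t)\,dt+\sigma_t(X_t)\,dW_t$ in $\mathbb R^N$, with $W$ an $M$-dimensional standard Brownian motion, $f_t$ an $N$-vector, $\sigma_t$ an $N\times M$ matrix, $a_t=\sigma_t\sigma_t'$. The Fokker-Planck equation is $\partial_tp_t=\mathcal L_t^*p_t$, where $\mathcal L_t=\sum_i f_i\,\partial_{x_i}+\frac12\sum_{i,j}a_{ij}\,\partial^2_{x_ix_j}$ and $\mathcal L_t^*p=-\sum_i\partial_{x_i}(f_ip)+\frac12\sum_{i,j}\partial^2_{x_ix_j}(a_{ij}p)$ (time arguments of $f$, $a$ suppressed). Written in exponential-chart coordinates centered at $p_t$, its vector field at a density $p$ is $\mathcal L_t^*p/p$. Operators and integrals are applied componentwise to vector functions. Exponential family. $c=(c_1,\dots,c_n)$, $c_i:\mathbb R^N\to\mathbb R$, $p(x,\theta)=\exp(\theta^Tc(x)-\psi(\theta))$ is a probability density with respect to Lebesgue measure for $\theta\in\Theta$, where $\Theta\subset\mathbb R^n$ is a maximal convex open set; $\mathrm{EF}(c)=\{p(\cdot,\theta):\theta\in\Theta\}$. $E_\theta$ is expectation under $p(\cdot,\theta)$, and $g(\theta)=[\mathrm{Cov}_{p(\cdot,\theta)}(c_i,c_j)]_{ij}=\mathrm{Hess}\,\psi(\theta)$ is the Fisher information matrix, assumed invertible, with inverse $[g^{ij}(\theta)]$. Assumptions: (A) $X_0$ is independent of $W$ and has an almost everywhere positive Lebesgue density $p_0$ with finite moments of every order. (B) $f$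 is once continuously differentiable in $x$ and continuous in $t$; $a$ is twice continuously differentiable in $x$ and continuous in $t$. (C) There is $K>0$ with $2x'f_t(x)+\|a_t(x)\|\le K(1+|x|^2)$ for all $t\ge0$, $x\in\mathbb R^N$. (E) $c\in C^2$. (F) $E_\theta\big[\big(\mathcal L_t^*p(\cdot,\theta)/p(\cdot,\theta)\big)^2\big]<\infty$ for all $\theta\in\Theta$, $t\ge0$. Projection. For $U$ with $E_\theta[U]=0$, $E_\theta[U^2]<\infty$, $$\Pi_\theta U=\sum_{i,j=1}^n g^{ij}(\theta)\,\mathrm{Cov}_{p(\cdot,\theta)}(U,c_i)\,(c_j-E_\theta c_j),$$ the $L^2(p(\cdot,\theta))$-orthogonal projection onto the tangent space $\mathrm{span}\{c_j-E_\theta c_j:j=1,\dots,n\}$. Duality convention. $\mathcal L_t^*$ is the dual of $\mathcal L_t$ in the sense that, for $p=p(\cdot,\theta)$, the integrals are finite and $\int c_i\,\mathcal L_t^*p\,dx=\int p\,\mathcal L_tc_i\,dx$, $\int\mathcal L_t^*p\,dx=0$. *)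

(* Defs.v *)
From HB Require Import structures.
From mathcomp Require Import all_boot all_order all_algebra.
From mathcomp Require Import lra.
From mathcomp Require Import all_classical all_reals all_analysis.
From mathcomp Require Import measurable_realfun.

Set Implicit Arguments.
Unset Strict Implicit.
Unset Printing Implicit Defensive.

Import Order.TTheory GRing.Theory Num.Theory.
Import numFieldNormedType.Exports.

Local Open Scope classical_set_scope.
Local Open Scope ring_scope.

(* R^N as row vectors, with the Borel sigma-algebra. *)
Definition borel_rV (R : realType) (N : nat) :=
  g_sigma_algebraType (@open 'rV[R]_N).

Section lebesgue_rV.
Variable R : realType.

Definition cons_rV N (z : measurableTypeR R * borel_rV R N) : borel_rV R N.+1 :=
  row_mx (z.1%:M : 'rV[R]_1) (z.2 : 'rV[R]_N).

Lemma cons_rVl N z i k : @cons_rV N z i (@lshift 1 N k) = z.1.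
Proof. by rewrite [LHS](row_mxEl z.1%:M) mxE !ord1 eqxx mulr1n. Qed.

Lemma cons_rVr N z i k : @cons_rV N z i (rshift 1 k) = (z.2 : 'rV_N) i k.
Proof. exact: (row_mxEr z.1%:M). Qed.

Lemma measurable_cons_rV N : measurable_fun setT (@cons_rV N).
Proof.
apply: (@measurability _ _ _ _ setT (@cons_rV N) (@open 'rV[R]_N.+1)) => //.
move=> _ [U oU <-]; rewrite setTI.
pose W (q r : rat) : set 'rV[R]_N := \bigcup_(V in [set V : set 'rV[R]_N |
  open V /\ forall x v, ball (ratr q : R) (ratr r) x -> V v ->
    U (@cons_rV N (x, v))]) V.
have -> : @cons_rV N @^-1` U =
    \bigcup_q \bigcup_r (ball (ratr q : R) (ratr r) `*` W q r).
  apply/seteqP; split => [[x v] /= Uxv|[x v] [q _ [r _ [/= qx [V [oV VU] Vv]]]]];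
    last exact: VU.
  have /nbhs_ballP[e /= e0 eU] : nbhs (@cons_rV N (x, v)) U.
    exact: open_nbhs_nbhs.
  have [r] := rat_in_itvoo (divr_gt0 e0 (ltr0n R 2)).
  rewrite in_itv/= => /andP[r0 re].
  have [q] : exists q : rat, ratr q \in `]x - ratr r, x + ratr r[.
    by apply: rat_in_itvoo; rewrite ltrBlDr -addrA ltrDl addr_gt0.
  rewrite in_itv/= => /andP[q1 q2].
  exists q => //; exists r => //; split => /=.
    by rewrite /ball/= ltr_norml; apply/andP; split; lra.
  exists (ball v e) => /=; last exact: ballxx.
  split; first exact: ball_open.
  move=> y w qy vw; apply: eU; split => // i j.
  rewrite /cons_rV /=; have [k ->|k ->] := @split_ordP 1 N j.
    have -> : @cons_rV N (x, v) i (@lshift 1 N k) = x by exact: cons_rVl.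
    have -> : @cons_rV N (y, w) i (@lshift 1 N k) = y by exact: cons_rVl.
    move: qy; rewrite /ball/= !ltr_norml => /andP[? ?]; apply/andP; split; lra.
  have -> : @cons_rV N (x, v) i (@rshift 1 N k) = v i k by exact: cons_rVr.
  have -> : @cons_rV N (y, w) i (@rshift 1 N k) = w i k by exact: cons_rVr.
  exact: vw.2.
apply: bigcupT_measurable_rat => q; apply: bigcupT_measurable_rat => r.
apply: measurableX; first by apply: open_measurable; exact: ball_open.
apply: sub_sigma_algebra => /=; rewrite /W.
by apply: bigcup_open => V [].
Qed.


Lemma sigma_finite_cons_rV N
    (m : {sigma_finite_measure set (borel_rV R N) -> \bar R}) :
  sigma_finite setT
    (pushforward (@lebesgue_measure R \x m)%E (@cons_rV N)).
Proof.
have /sigma_finiteP[F [TF ndF Foo]] := sigma_finiteT (@lebesgue_measure R).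
have /sigma_finiteP[G [TG ndG Goo]] := sigma_finiteT m.
pose FG k : set (measurableTypeR R * borel_rV R N) := F k `*` G k.
pose s (w : borel_rV R N.+1) : measurableTypeR R * borel_rV R N :=
  ((w : 'rV_N.+1) ord0 ord0, @rsubmx R 1 1 N w).
have sK z : s (cons_rV z) = z.
  case: z => x v; rewrite /s; congr pair; last exact: (row_mxKr (x%:M : 'rV_1)).
  by rewrite (_ : ord0 = @lshift 1 N ord0) ?cons_rVl//; exact/val_inj.
have ms : measurable_fun setT s.
  apply: measurable_fun_pair.
    apply: (@measurability _ _ _ _ setT _ _ (RGenOpens.measurableE R)).
    move=> _ [_ [x [y ->]] <-]; rewrite setTI; apply: sub_sigma_algebra.
    apply: (@open_comp _ _ (fun w : 'rV[R]_N.+1 => w ord0 ord0)).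
      by move=> w _; exact: coord_continuous.
    exact: interval_open.
  pose r (w : borel_rV R N.+1) : borel_rV R N := @rsubmx R 1 1 N w.
  suff : measurable_fun setT r by [].
  apply: (@measurability _ _ _ _ setT r (@open 'rV[R]_N)) => //.
  move=> _ [U oU <-]; rewrite setTI; apply: sub_sigma_algebra.
  apply: (@open_comp 'rV[R]_N.+1 'rV[R]_N r) => //.
  by move=> w _; exact: (@continuous_rsubmx _ 1 1 N).
exists (fun k => s @^-1` FG k).
  apply/seteqP; split => // w _.
  have [i _ Fi] : (\bigcup_k F k) (s w).1 by rewrite -TF.
  have [j _ Gj] : (\bigcup_k G k) (s w).2 by rewrite -TG.
  exists (maxn i j) => //; split => /=.
    by move: Fi; exact/subsetPset/ndF/leq_maxl.
  by move: Gj; exact/subsetPset/ndG/leq_maxr.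
move=> k; have [mF ?] := Foo k; have [mG ?] := Goo k.
have mFG : measurable (FG k) by exact: measurableX.
split; first by rewrite -[X in measurable X]setTI; exact: ms.
rewrite /pushforward (_ : _ @^-1` _ = FG k).
  by rewrite product_measure1E// lte_mul_pinfty// ge0_fin_numE.
by apply/seteqP; split => z /=; rewrite sK.
Qed.

Definition lebesgue_cons N
  (m : {sigma_finite_measure set (borel_rV R N) -> \bar R}) :
    set (borel_rV R N.+1) -> \bar R :=
  pushforward (@lebesgue_measure R \x m)%E (@cons_rV N).

Section lebesgue_cons.
Variables (N : nat) (m : {sigma_finite_measure set (borel_rV R N) -> \bar R}).

Let mu : {measure set (borel_rV R N.+1) -> \bar R} :=
  measure_function_pushforward__canonical__measure_function_Measure
    (@lebesgue_measure R \x m)%E (@measurable_cons_rV N).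

HB.instance Definition _ := Measure.copy (lebesgue_cons m) mu.

HB.instance Definition _ := @Measure_isSigmaFinite.Build _ _ _
  (lebesgue_cons m) (sigma_finite_cons_rV m).

End lebesgue_cons.

(* N-dimensional Lebesgue measure, as the N-fold product of lebesgue_measure. *)
Fixpoint lebesgue_rV N : {sigma_finite_measure set (borel_rV R N) -> \bar R} :=
  match N with
  | 0 => \d_(0 : borel_rV R 0)
  | N'.+1 => lebesgue_cons (lebesgue_rV N')
  end.

End lebesgue_rV.


Section calculus.
Variables (R : realType) (N : nat).
Implicit Types (F p phi : 'rV[R]_N -> R).

Definition partial (i : 'I_N) F : 'rV[R]_N -> R :=
  fun x => 'D_(delta_mx 0 i) F x.

Definition C1 F :=
  (forall x, differentiable F x) /\ (forall i, continuous (partial i F)).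

Definition C2 F := C1 F /\ (forall i, C1 (partial i F)).

Definition generator (f : 'rV[R]_N -> 'rV[R]_N) (a : 'rV[R]_N -> 'M[R]_N) phi :
    'rV[R]_N -> R := fun x =>
  \sum_(i < N) f x 0 i * partial i phi x +
  2^-1 * \sum_(i < N) \sum_(j < N) a x i j * partial i (partial j phi) x.

Definition generator_adj (f : 'rV[R]_N -> 'rV[R]_N) (a : 'rV[R]_N -> 'M[R]_N) p :
    'rV[R]_N -> R := fun x =>
  - \sum_(i < N) partial i (fun y => f y 0 i * p y) x +
  2^-1 * \sum_(i < N) \sum_(j < N)
    partial i (partial j (fun y => a y i j * p y)) x.

(* The Fokker-Planck vector field at p, in the exponential chart at p. *)
Definition fokker_planck_field f a p : 'rV[R]_N -> R :=
  fun x => generator_adj f a p x / p x.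

(* Derivative at t relative to J; one-sided when t is an endpoint of J. *)
Definition has_derivative_in (V : normedModType R) (J : set R) (u : R -> V)
    (t : R) (v : V) :=
  h^-1 *: (u (t + h) - u t) @[h --> within [set h | J (t + h)] (0 : R)^'] --> v.

End calculus.

Section coefficients.
Variables (R : realType) (N : nat).

Definition regular_coefficients (f : R -> 'rV[R]_N -> 'rV[R]_N)
    (a : R -> 'rV[R]_N -> 'M[R]_N) :=
  [/\ forall t i, 0 <= t -> C1 (fun x => f t x 0 i),
      forall x, {within `[0, +oo[%classic, continuous (fun t => f t x)},
      forall t i j, 0 <= t -> C2 (fun x => a t x i j) &
      forall x, {within `[0, +oo[%classic, continuous (fun t => a t x)}].

Definition is_matrix_norm (nrm : 'M[R]_N -> R) :=
  [/\ forall A, nrm A = 0 -> A = 0,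
      forall A B, nrm (A + B) <= nrm A + nrm B &
      forall k A, nrm (k *: A) = `|k| * nrm A].

(* x *m y^T is the Euclidean inner product; the norm of 'rV[R]_N is the sup
   norm, hence not used for |x|^2. *)
Definition non_explosion (nrm : 'M[R]_N -> R) (f : R -> 'rV[R]_N -> 'rV[R]_N)
    (a : R -> 'rV[R]_N -> 'M[R]_N) :=
  exists2 K : R, 0 < K & forall t x, 0 <= t ->
    2 * (x *m (f t x)^T) 0 0 + nrm (a t x) <= K * (1 + (x *m x^T) 0 0).

End coefficients.

Section stochastic.
Context d (Omega : measurableType d) (R : realType) (P : probability Omega R).
Implicit Types (F : R -> set (set Omega)).

Definition measurable_wrt (G : set (set Omega)) d' (T : measurableType d')
    (Y : Omega -> T) := forall B, measurable B -> G (Y @^-1` B).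

Definition is_filtration F :=
  [/\ forall t, 0 <= t -> sigma_algebra setT (F t),
      forall t, 0 <= t -> F t `<=` measurable &
      forall s t, 0 <= s -> s <= t -> F s `<=` F t].

Definition adapted F d' (T : measurableType d') (Y : R -> Omega -> T) :=
  forall t, 0 <= t -> measurable_wrt (F t) (Y t).

(* For s < t, the increment W t - W s is independent of F s and has law
   N(0, (t - s) I_M). *)
Definition is_brownian F M (W : R -> Omega -> 'rV[R]_M) :=
  [/\ adapted F (W : R -> Omega -> borel_rV R M),
      {ae P, forall w, W 0 w = 0},
      forall s t (A : set Omega) (B : 'I_M -> set (measurableTypeR R)),
        0 <= s -> s < t -> F s A -> (forall j, measurable (B j)) ->
        P (A `&` [set w | forall j, B j (W t w 0 j - W s w 0 j)]) =
        (P A * (\prod_(j < M) fine (normal_prob 0 (Num.sqrt (t - s)) (B j)))%:E)%E &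
      {ae P, forall w, {within `[0, +oo[%classic, continuous (W ^~ w)}}].

(* Encodes the process \sum_(l < sp_size) sp_coef l * 1_]sp_time l, sp_time l.+1]. *)
Record simple_process := SimpleProcess {
  sp_size : nat;
  sp_time : nat -> R;
  sp_coef : nat -> Omega -> R }.

Definition is_simple F (T : R) (S : simple_process) :=
  [/\ 0 <= sp_time S 0,
      forall l, (l < sp_size S)%N -> sp_time S l <= sp_time S l.+1,
      sp_time S (sp_size S) <= T &
      forall l, (l < sp_size S)%N ->
        measurable_wrt (F (sp_time S l))
          (sp_coef S l : Omega -> measurableTypeR R) /\
        exists C : R, forall w, `|sp_coef S l w| <= C].

Definition simple_eval (S : simple_process) (t : R) (w : Omega) : R :=
  \sum_(l < sp_size S)
    sp_coef S l w * \1_(`]sp_time S l, sp_time S l.+1]%classic) t.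

Definition simple_integral (S : simple_process) (B : R -> Omega -> R)
    (w : Omega) : R :=
  \sum_(l < sp_size S)
    sp_coef S l w * (B (sp_time S l.+1) w - B (sp_time S l) w).

(* I is (a version of) the Ito integral of H against the real Brownian motion B
   over [0, T].  Almost sure convergence along a sequence replaces convergence
   in probability: both give the same I, by extraction of a subsequence. *)
Definition is_ito_integral F (B H : R -> Omega -> R) (T : R) (I : Omega -> R) :=
  [/\ measurable_fun (`[0, T]%classic `*` setT)
        (fun z : measurableTypeR R * Omega => H z.1 z.2),
      forall t, 0 <= t <= T ->
        measurable_wrt (F t) (H t : Omega -> measurableTypeR R) &
      exists S : nat -> simple_process,
        [/\ forall m, is_simple F T (S m),
            {ae P, forall w, (\int[lebesgue_measure]_(t in `[0%R, T])
              ((simple_eval (S m) t w - H t w) ^+ 2)%:E)%E @[m --> \oo] --> 0%E} &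
            {ae P, forall w,
              simple_integral (S m) B w @[m --> \oo] --> I w}]].

Definition sde_solution N M F (W : R -> Omega -> 'rV[R]_M)
    (f : R -> 'rV[R]_N -> 'rV[R]_N) (sigma : R -> 'rV[R]_N -> 'M[R]_(N, M))
    (X : R -> Omega -> 'rV[R]_N) :=
  [/\ adapted F (X : R -> Omega -> borel_rV R N),
      {ae P, forall w, {within `[0, +oo[%classic, continuous (X ^~ w)}} &
      forall t i, 0 <= t ->
        {ae P, forall w, lebesgue_measure.-integrable `[0, t]
          (fun s => (f s (X s w) 0 i)%:E)} /\
        exists I : 'I_M -> Omega -> R,
          (forall j, is_ito_integral F (fun s w => W s w 0 j)
             (fun s w => sigma s (X s w) i j) t (I j)) /\
          {ae P, forall w, X t w 0 i = X 0 w 0 i +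
             \int[lebesgue_measure]_(s in `[0, t]) f s (X s w) 0 i +
             \sum_(j < M) I j w}].

Definition independent_of_process N M (X0 : Omega -> 'rV[R]_N)
    (W : R -> Omega -> 'rV[R]_M) :=
  forall (A : set (borel_rV R N)) (E : set Omega), measurable A ->
    <<s [set D | exists2 t : R, 0 <= t &
          exists2 B : set (borel_rV R M), measurable B & D = W t @^-1` B] >> E ->
    P ((X0 @^-1` A) `&` E) = (P (X0 @^-1` A) * P E)%E.

Definition has_density N (Y : Omega -> 'rV[R]_N) (p : borel_rV R N -> R) :=
  [/\ measurable_fun setT p, forall x, 0 <= p x &
      forall A : set (borel_rV R N), measurable A ->
        P (Y @^-1` A) = (\int[lebesgue_rV R N]_(x in A) (p x)%:E)%E].

Definition initial_condition N M (X0 : Omega -> 'rV[R]_N)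
    (W : R -> Omega -> 'rV[R]_M) (p0 : 'rV[R]_N -> R) :=
  [/\ independent_of_process X0 W,
      has_density X0 p0,
      {ae lebesgue_rV R N, forall x, 0 < p0 x} &
      forall k : nat,
        (\int[lebesgue_rV R N]_x (`|x : 'rV[R]_N| ^+ k * p0 x)%:E < +oo)%E].

End stochastic.

Section exponential_family.
Variables (R : realType) (N n : nat).
Local Notation mu := (lebesgue_rV R N).
Implicit Types (c : 'I_n -> 'rV[R]_N -> R) (p U V : 'rV[R]_N -> R).

Definition probability_density p :=
  [/\ measurable_fun setT (p : borel_rV R N -> R), forall x, 0 <= p x &
      (\int[mu]_x (p x)%:E = 1)%E].

Definition expectation p U : R := \int[mu]_x (U x * p x).

Definition covariance p U V : R :=
  expectation p (fun x => (U x - expectation p U) * (V x - expectation p V)).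

Definition statistics c (x : 'rV[R]_N) : 'cV[R]_n := \col_i c i x.

Definition mean_statistics c p : 'cV[R]_n := \col_i expectation p (c i).

Definition log_partition c (theta : 'cV[R]_n) : R :=
  ln (\int[mu]_x expR ((theta^T *m statistics c x) 0 0)).

(* When the integral in log_partition is infinite, ef_density c theta is not a
   probability density. *)
Definition ef_density c (theta : 'cV[R]_n) : 'rV[R]_N -> R :=
  fun x => expR ((theta^T *m statistics c x) 0 0 - log_partition c theta).

Definition maximal_parameter_set c (Theta : set 'cV[R]_n) :=
  let admissible (S : set 'cV[R]_n) :=
    [/\ open S, convex_set S &
        forall theta, S theta -> probability_density (ef_density c theta)] in
  admissible Theta /\
  forall S, admissible S -> Theta `<=` S -> S `<=` Theta.

Definition fisher c (theta : 'cV[R]_n) : 'M[R]_n :=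
  \matrix_(i, j) covariance (ef_density c theta) (c i) (c j).

Definition tangent_projection c (theta : 'cV[R]_n) U : 'rV[R]_N -> R :=
  let p := ef_density c theta in
  fun x => \sum_(i < n) \sum_(j < n)
    invmx (fisher c theta) i j * covariance p U (c i) *
    (c j x - expectation p (c j)).

Definition mean_generator (f : 'rV[R]_N -> 'rV[R]_N) (a : 'rV[R]_N -> 'M[R]_N)
    c p : 'cV[R]_n :=
  \col_i expectation p (generator f a (c i)).

Definition generator_duality (f : 'rV[R]_N -> 'rV[R]_N)
    (a : 'rV[R]_N -> 'M[R]_N) c p :=
  [/\ mu.-integrable setT (fun x => (generator_adj f a p x)%:E),
      \int[mu]_x generator_adj f a p x = 0 &
      forall i,
        [/\ mu.-integrable setT (fun x => (c i x * generator_adj f a p x)%:E),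
            mu.-integrable setT (fun x => (p x * generator f a (c i) x)%:E) &
            \int[mu]_x (c i x * generator_adj f a p x) =
            \int[mu]_x (p x * generator f a (c i) x)]].

End exponential_family.

(* Main.v *)
Require Import Defs.
From HB Require Import structures.
From mathcomp Require Import all_boot all_order all_algebra.
From mathcomp Require Import ring lra.
From mathcomp Require Import all_classical all_reals all_analysis.
From mathcomp Require Import measurable_realfun.

(** Write <u, v> for the inner product of column vectors, psi for the log
partition function, p for the density at th, and m for the mean of c under p.
The logarithm of the density at th is <th, c(x)> - psi(th), so everything rests
on three facts.

Along a differentiable curve, log p has derivative <c(x) - m, dtheta>: this says
that psi is differentiable on the open set Theta with gradient m.  Rather than
differentiating under the integral, one bounds psi near th from both sides.
The densities at th + h and at th differ by the factor
exp(<h, c> - (psi(th + h) - psi(th))), whose mean under p is 1.  From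
1 + y <= exp(y) one gets <h, m> <= psi(th + h) - psi(th)
([log_partition_ge]), and from exp(y) <= 1 + y + y^2 exp|y| one gets
psi(th + h) - psi(th) <= <h, m> + C |h|^2 ([log_partition_le]).  The constant C
is finite because openness of Theta provides exponential moments of every c_i in
both directions ([exp_majorant_integrable]).  An expansion with quadratic
remainder composes with difference quotients, also at an endpoint of the
interval ([has_derivative_in_comp]).

The covariance of L* p / p with c_i is the mean of L c_i: the factors p cancel
under the integral and duality moves L* onto c_i
([covariance_fokker_planck]).  Hence the projected field is
E[L c]^T g^-1 (c(x) - m), and, derivatives along a nondegenerate interval being
unique, the projected equation is equivalent to the explicit one.

The explicit equation says that w = dtheta - g^-1 E[L c] is orthogonal to
c(x) - m for every x.  Then g w, whose entries are the covariances of the c_i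
with <c - m, w>, vanishes ([fisher_ker]), and w = 0 since g is invertible. *)

Set Implicit Arguments.
Unset Strict Implicit.
Unset Printing Implicit Defensive.

Import Order.TTheory GRing.Theory Num.Theory.
Import numFieldNormedType.Exports.

Local Open Scope classical_set_scope.
Local Open Scope ring_scope.

(* Moments here are taken under a density on R^N, not under a probability on
   an abstract space. *)
Local Notation expectation := Defs.expectation.
Local Notation covariance := Defs.covariance.

(** * Means under a density *)

Lemma continuous_measurable_rV (R : realType) (N : nat) (g : 'rV[R]_N -> R) :
  continuous g -> measurable_fun setT (g : borel_rV R N -> R).
Proof.
move=> cg; apply: (measurability _ (RGenOpens.measurableE R)).
move=> _ [_ [x [y ->]] <-]; rewrite setTI; apply: sub_sigma_algebra.
by apply: open_comp => [z _|]; [exact: cg|exact: interval_open].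
Qed.

Lemma C2_measurable (R : realType) (N : nat) (g : 'rV[R]_N -> R) :
  C2 g -> measurable_fun setT (g : borel_rV R N -> R).
Proof.
move=> [[dg _] _]; apply: continuous_measurable_rV => x.
exact: differentiable_continuous.
Qed.

(** The integrand is kept in the form U x * p x, the one in which [expectation]
multiplies, so that linearity of the mean follows from that of the integral. *)
Definition integrable_wrt (R : realType) (N : nat) (p U : 'rV[R]_N -> R) :=
  (lebesgue_rV R N).-integrable setT (fun x => (U x * p x)%:E).

Section expectation_theory.
Variables (R : realType) (N : nat) (p : 'rV[R]_N -> R).
Implicit Types U V : 'rV[R]_N -> R.

Lemma integrable_wrtZ k U :
  integrable_wrt p U -> integrable_wrt p (fun x => k * U x).
Proof.
move=> iU; apply: eq_integrable (integrableZl measurableT k iU) => // x _.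
by rewrite -EFinM mulrA.
Qed.

Lemma integrable_wrtD U V :
  integrable_wrt p U -> integrable_wrt p V ->
  integrable_wrt p (fun x => U x + V x).
Proof.
move=> iU iV; apply: eq_integrable (integrableD measurableT iU iV) => // x _.
by rewrite -EFinD mulrDl.
Qed.

Lemma expectationZ k U : integrable_wrt p U ->
  expectation p (fun x => k * U x) = k * expectation p U.
Proof.
move=> iU; rewrite /expectation -(RintegralZl _ _ iU)//.
by apply: eq_Rintegral => x _; rewrite mulrA.
Qed.

Lemma expectationD U V : integrable_wrt p U -> integrable_wrt p V ->
  expectation p (fun x => U x + V x) = expectation p U + expectation p V.
Proof.
move=> iU iV; rewrite /expectation -(RintegralD _ iU iV)//.
by apply: eq_Rintegral => x _; rewrite mulrDl.
Qed.

Lemma integrable_wrt0 : integrable_wrt p (fun=> 0).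
Proof.
by apply: eq_integrable (integrable0 _ _) => // x _; rewrite mul0r.
Qed.

Lemma expectation0 : expectation p (fun=> 0) = 0.
Proof.
rewrite /expectation (eq_Rintegral _ (g := fun=> 0)) => [|x _]; last exact: mul0r.
by rewrite Rintegral_cst// mul0r.
Qed.

Lemma integrable_wrt_sum (I : finType) (G : I -> 'rV[R]_N -> R) :
  (forall i, integrable_wrt p (G i)) ->
  integrable_wrt p (fun x => \sum_i G i x).
Proof.
move=> iG; elim: (index_enum I) => [|i r IH].
  by under eq_fun do rewrite big_nil; exact: integrable_wrt0.
by under eq_fun do rewrite big_cons; exact: integrable_wrtD.
Qed.

Lemma expectation_sum (I : finType) (G : I -> 'rV[R]_N -> R) :
  (forall i, integrable_wrt p (G i)) ->
  expectation p (fun x => \sum_i G i x) = \sum_i expectation p (G i).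
Proof.
move=> iG; suff /(_ (index_enum I))[] : forall r : seq I,
    integrable_wrt p (fun x => \sum_(i <- r) G i x) /\
    expectation p (fun x => \sum_(i <- r) G i x) =
      \sum_(i <- r) expectation p (G i) by [].
elim=> [|i r [IH1 IH2]].
  rewrite big_nil; under eq_fun do rewrite big_nil.
  by split; [exact: integrable_wrt0|exact: expectation0].
rewrite big_cons -IH2 -expectationD//; under eq_fun do rewrite big_cons.
by split; first exact: integrable_wrtD.
Qed.

Lemma eq_expectation U V : U =1 V -> expectation p U = expectation p V.
Proof. by move=> UV; rewrite (funext UV). Qed.

Hypothesis p_density : probability_density p.

Lemma ler_expectation U V : integrable_wrt p U -> integrable_wrt p V ->
  (forall x, U x <= V x) -> expectation p U <= expectation p V.
Proof.
have [_ p0 _] := p_density.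
by move=> iU iV UV; apply: le_Rintegral => // x _; rewrite ler_wpM2r.
Qed.

Lemma integrable_wrt_le U V :
  measurable_fun setT (U : borel_rV R N -> R) ->
  (forall x, `|U x| <= V x) -> integrable_wrt p V -> integrable_wrt p U.
Proof.
have [mp p0 _] := p_density.
move=> mU UV; apply: le_integrable => //.
  by apply/measurable_EFinP; exact: measurable_funM.
move=> x _; rewrite lee_fin !normrM ler_wpM2r//.
exact: le_trans (UV x) (ler_norm _).
Qed.

Lemma integrable_wrt_cst k : integrable_wrt p (fun=> k).
Proof.
have [mp p0 p1] := p_density.
have ip : (lebesgue_rV R N).-integrable setT (EFin \o p).
  apply/integrableP; split; first exact/measurable_EFinP.
  under eq_integral do rewrite /= ger0_norm//.
  by rewrite p1 ltry.
by apply: eq_integrable (integrableZl measurableT k ip) => // x _.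
Qed.

Lemma expectation_cst k : expectation p (fun=> k) = k.
Proof.
have [_ _ p1] := p_density.
have -> : expectation p (fun=> k) = expectation p (fun=> k * 1).
  by apply: eq_expectation => x; rewrite mulr1.
rewrite expectationZ; last exact: integrable_wrt_cst.
rewrite /expectation; under eq_Rintegral do rewrite mul1r.
by rewrite /Rintegral p1 mulr1.
Qed.

End expectation_theory.

(** * Exponential bounds on column vectors *)

Definition dotc (R : realType) (n : nat) (u v : 'cV[R]_n) : R := (u^T *m v) 0 0.

Lemma dotcE (R : realType) (n : nat) (u v : 'cV[R]_n) :
  dotc u v = \sum_i u i 0 * v i 0.
Proof. by rewrite /dotc mxE; apply: eq_bigr => i _; rewrite mxE. Qed.

Lemma dotcDl (R : realType) (n : nat) (u v w : 'cV[R]_n) :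
  dotc (u + v) w = dotc u w + dotc v w.
Proof. by rewrite /dotc raddfD/= mulmxDl mxE. Qed.

Lemma dotcC (R : realType) (n : nat) (u v : 'cV[R]_n) : dotc u v = dotc v u.
Proof. by rewrite !dotcE; apply: eq_bigr => i _; rewrite mulrC. Qed.

Lemma dotcZl (R : realType) (n : nat) k (u v : 'cV[R]_n) :
  dotc (k *: u) v = k * dotc u v.
Proof. by rewrite /dotc linearZ/= -scalemxAl mxE. Qed.

Lemma coord_le_norm (R : realType) (n : nat) (z : 'cV[R]_n) i : `|z i 0| <= `|z|.
Proof.
rewrite [leRHS]mx_normrE.
exact: (le_bigmax _ (fun ij => `|z ij.1 ij.2|) (i, 0)).
Qed.

Lemma norm_dotc_le (R : realType) (n : nat) (u z : 'cV[R]_n) :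
  `|dotc u z| <= n%:R * `|u| * `|z|.
Proof.
rewrite dotcE; apply: le_trans (ler_norm_sum _ _ _) _.
apply: (@le_trans _ _ (\sum_(i < n) `|u| * `|z|)).
  by apply: ler_sum => i _; rewrite normrM ler_pM// coord_le_norm.
by rewrite sumr_const card_ord -mulrA mulr_natl.
Qed.

(** Both steps come from exp(y) (1 - y) <= 1, that is, 1 - y <= exp(- y): first
exp(y) - 1 - y <= y (exp(y) - 1), then y (exp(y) - 1) <= y^2 exp|y|. *)
Lemma expR_le_quadratic (R : realType) (y : R) :
  expR y <= 1 + y + y ^+ 2 * expR `|y|.
Proof.
have e1 : expR y * (1 - y) <= 1.
  rewrite -[leRHS](expRxMexpNx_1 y) ler_wpM2l ?expR_ge0//.
  exact: expR_ge1Dx.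
have [y0|y0] := leP 0 y.
  rewrite ger0_norm//; have := expR_ge1Dx y; nra.
rewrite ltr0_norm//; have := expR_ge1Dx y; have := expR_ge1Dx (- y); nra.
Qed.

(** A finite sum of exponentials of linear functions of z, which dominates
exp(e |z|) in positive dimension.  Under the density at th its mean is finite as
soon as moving any coordinate of th by e in either direction stays admissible. *)
Definition exp_majorant (R : realType) (n : nat) (e : R) (z : 'cV[R]_n) : R :=
  \sum_i (expR (e * z i 0) + expR (- e * z i 0)).

(** For nonzero z the sup norm is attained at some coordinate i, so exp(e |z|) is
either exp(e z_i) or exp(- e z_i), a term of the majorant.  The square is
absorbed by one of the two halves of exp(e |z|). *)
Lemma sqr_norm_expR_le (R : realType) (n : nat) (e : R) (z : 'cV[R]_n) :
  0 < e ->
  `|z| ^+ 2 * expR (e / 2 * `|z|) <= 16 / e ^+ 2 * exp_majorant e z.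
Proof.
move=> e0.
have D0 : 0 <= exp_majorant e z.
  by apply: sumr_ge0 => i _; rewrite addr_ge0// expR_ge0.
have [z0|/mx_norm_neq0[[i j]]] := eqVneq `|z| 0.
  by rewrite z0 expr0n/= mul0r mulr_ge0// divr_ge0// sqr_ge0.
rewrite ord1 /= -[mx_norm z]/`|z| => zi.
have zD : expR (e * `|z|) <= exp_majorant e z.
  rewrite /exp_majorant (bigD1 i)//= -[leLHS]addr0 lerD//; last first.
    by apply: sumr_ge0 => k _; rewrite addr_ge0// expR_ge0.
  rewrite zi; have [z0|z0] := leP 0 (z i 0).
    by rewrite ger0_norm// lerDl expR_ge0.
  by rewrite ltr0_norm// mulrN -mulNr lerDr expR_ge0.
have z0 : 0 <= `|z| by [].
have e2 : expR (e * `|z|) = expR (e / 2 * `|z|) * expR (e / 2 * `|z|).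
  by rewrite -expRD; congr expR; lra.
have e4 : expR (e / 2 * `|z|) = expR (e / 4 * `|z|) ^+ 2.
  by rewrite expr2 -expRD; congr expR; lra.
have b : `|z| ^+ 2 <= 16 / e ^+ 2 * expR (e / 2 * `|z|).
  have -> : `|z| ^+ 2 = 16 / e ^+ 2 * (e / 4 * `|z|) ^+ 2.
    by field; rewrite gt_eqF.
  rewrite ler_wpM2l ?divr_ge0 ?sqr_ge0// e4 ler_pXn2r ?nnegrE ?expR_ge0//.
    by have := expR_ge1Dx (e / 4 * `|z|); lra.
  by rewrite mulr_ge0// divr_ge0// ltW.
apply: (@le_trans _ _ (16 / e ^+ 2 * expR (e * `|z|))).
  by rewrite e2 mulrA ler_wpM2r// expR_ge0.
by rewrite ler_wpM2l// divr_ge0// sqr_ge0.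
Qed.

(** The pointwise inequality behind the differentiability of the log partition
function: the remainder is at most |h|^2 times a function of z that does not depend
on h. *)
Lemma expR_dotc_le (R : realType) (n : nat) (e : R) (h z : 'cV[R]_n) :
  0 < e -> n%:R * `|h| <= e / 2 ->
  expR (dotc h z) <=
    1 + dotc h z + 16 / e ^+ 2 * (n%:R * `|h|) ^+ 2 * exp_majorant e z.
Proof.
move=> e0 he; apply: le_trans (expR_le_quadratic _) _; rewrite lerD2l.
have nh0 : 0 <= n%:R * `|h| by rewrite mulr_ge0.
apply: (@le_trans _ _ ((n%:R * `|h|) ^+ 2 * (`|z| ^+ 2 * expR (e / 2 * `|z|)))).
  have hz := norm_dotc_le h z.
  rewrite mulrA -exprMn -(real_normK (num_real (dotc h z))).
  rewrite ler_pM ?sqr_ge0 ?expR_ge0 ?lerXn2r ?nnegrE ?mulr_ge0//.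
  by rewrite ler_expR (le_trans hz)// ler_wpM2r.
rewrite [X in _ <= X * _]mulrC -[leRHS]mulrA ler_wpM2l ?sqr_ge0//.
exact: sqr_norm_expR_le.
Qed.

(** * The log partition function near an admissible parameter *)

Section exponential_family_theory.
Variables (R : realType) (N n : nat) (c : 'I_n -> 'rV[R]_N -> R).
Hypothesis c_measurable :
  forall i, measurable_fun setT (c i : borel_rV R N -> R).
Implicit Types th h : 'cV[R]_n.

Lemma ef_density_gt0 th x : 0 < ef_density c th x.
Proof. exact: expR_gt0. Qed.

Lemma ln_ef_density th x :
  ln (ef_density c th x) = dotc th (statistics c x) - log_partition c th.
Proof. exact: expRK. Qed.

(** Moving the parameter by h multiplies the density by an exponential of
<h, c>.  Hence the mean of exp <h, c> at th is the ratio of the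
normalizing constants. *)
Lemma ef_density_tilt th h x :
  expR (dotc h (statistics c x)) * ef_density c th x =
  expR (log_partition c (th + h) - log_partition c th) * ef_density c (th + h) x.
Proof.
have shift (u v k l : R) : expR (u + (v - k)) = expR (l - k + (v + u - l)).
  by congr expR; ring.
have := dotcDl th h (statistics c x); rewrite /ef_density -!expRD /dotc => ->.
exact: shift.
Qed.

Lemma expR_dotc_integrable th h :
  probability_density (ef_density c (th + h)) ->
  integrable_wrt (ef_density c th) (fun x => expR (dotc h (statistics c x))).
Proof.
move=> /integrable_wrt_cst ip.
apply: eq_integrable
  (ip (expR (log_partition c (th + h) - log_partition c th))) => [|x _]; first by [].
by rewrite ef_density_tilt.
Qed.

Lemma expectation_expR_dotc th h :
  probability_density (ef_density c (th + h)) ->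
  expectation (ef_density c th) (fun x => expR (dotc h (statistics c x))) =
  expR (log_partition c (th + h) - log_partition c th).
Proof.
move=> ph; rewrite -[RHS](expectation_cst ph) /Defs.expectation.
by apply: eq_Rintegral => x _; rewrite ef_density_tilt.
Qed.

(** Openness of the parameter set makes every th + k e_i with k small admissible,
which bounds the exponential moments of each statistic on both sides. *)
Lemma exp_majorant_integrable (Theta : set 'cV[R]_n) th :
  open Theta -> Theta th ->
  (forall th, Theta th -> probability_density (ef_density c th)) ->
  exists2 e, 0 < e &
    integrable_wrt (ef_density c th) (fun x => exp_majorant e (statistics c x)).
Proof.
move=> oT Tth dT.
have /nbhs_ballP[r /= r0 rT] : nbhs th Theta by exact: open_nbhs_nbhs.
exists (r / 2); first by rewrite divr_gt0.
have coordE k (i : 'I_n) (z : 'cV[R]_n) :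
    expR (k * z i 0) = expR (dotc (k *: delta_mx i 0) z).
  rewrite dotcE (bigD1 i)//= !mxE !eqxx/= mulr1 big1 ?addr0// => j ji.
  by rewrite !mxE (negbTE ji) mulr0 mul0r.
have ik k (i : 'I_n) : `|k| < r ->
    integrable_wrt (ef_density c th) (fun x => expR (k * statistics c x i 0)).
  move=> kr; under eq_fun do rewrite coordE.
  apply: expR_dotc_integrable; apply/dT/rT; rewrite -ball_normE/=.
  rewrite opprD addNKr normrN normrZ (le_lt_trans _ kr)// ler_piMr//.
  rewrite [leLHS]mx_normrE; apply/bigmax_leP; split => //= -[a b] _ /=.
  by rewrite mxE; case: (_ && _); rewrite ?normr1 ?normr0.
apply: integrable_wrt_sum => i; apply: integrable_wrtD; apply: ik.
  by rewrite gtr0_norm ?divr_gt0//; lra.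
by rewrite normrN gtr0_norm ?divr_gt0//; lra.
Qed.

Section moments.
Variables (th : 'cV[R]_n) (e : R).
Hypothesis p_density : probability_density (ef_density c th).
Hypothesis e_gt0 : 0 < e.
Hypothesis majorant_integrable :
  integrable_wrt (ef_density c th) (fun x => exp_majorant e (statistics c x)).

(** An exponential moment of |c| controls its second moments. *)
Lemma statistics_integrable2 i j :
  integrable_wrt (ef_density c th) (fun x => c i x * c j x).
Proof.
apply: (integrable_wrt_le p_density).
- exact: measurable_funM.
- move=> x; have := sqr_norm_expR_le (statistics c x) e_gt0; apply: le_trans.
  rewrite normrM; apply: (@le_trans _ _ (`|statistics c x| ^+ 2)).
    have ci k : `|c k x| <= `|statistics c x|.
      by have := coord_le_norm (statistics c x) k; rewrite mxE.
    by rewrite expr2 ler_pM.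
  rewrite ler_peMr ?sqr_ge0//.
  have : 0 <= e / 2 * `|statistics c x| by rewrite mulr_ge0// divr_ge0// ltW.
  by have := expR_ge1Dx (e / 2 * `|statistics c x|); lra.
- exact: integrable_wrtZ.
Qed.

Lemma statistics_integrable i : integrable_wrt (ef_density c th) (c i).
Proof.
apply: (@integrable_wrt_le _ _ _ p_density _ (fun x => 1 + c i x * c i x)) => //.
  by move=> x; rewrite ler_norml; apply/andP; split; nra.
apply: integrable_wrtD; first exact: integrable_wrt_cst.
exact: statistics_integrable2.
Qed.

Lemma dotc_integrable h :
  integrable_wrt (ef_density c th) (fun x => dotc h (statistics c x)).
Proof.
under eq_fun do rewrite dotcE.
apply: integrable_wrt_sum => i; under eq_fun do rewrite mxE.
exact/integrable_wrtZ/statistics_integrable.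
Qed.

Lemma expectation_dotc h :
  expectation (ef_density c th) (fun x => dotc h (statistics c x)) =
  dotc h (mean_statistics c (ef_density c th)).
Proof.
under eq_expectation do rewrite dotcE.
rewrite expectation_sum => [|i]; last first.
  by under eq_fun do rewrite mxE; exact/integrable_wrtZ/statistics_integrable.
rewrite dotcE; apply: eq_bigr => i _; rewrite mxE -expectationZ.
  by apply: eq_expectation => x; rewrite mxE.
exact: statistics_integrable.
Qed.

(** Jensen's inequality for the exponential, in its tangent form 1 + y <= exp(y)
with y = <h, c> - (psi(th + h) - psi(th)), where exp(y) has mean 1 under the
density at th. *)
Lemma log_partition_ge h : probability_density (ef_density c (th + h)) ->
  dotc h (mean_statistics c (ef_density c th)) <=
  log_partition c (th + h) - log_partition c th.
Proof.
move=> ph; set D := log_partition c (th + h) - _.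
have iD := integrable_wrt_cst p_density (1 - D).
have : expectation (ef_density c th)
      (fun x => (1 - D) + dotc h (statistics c x)) <= 1.
  rewrite -[leRHS](mulVf (lt0r_neq0 (expR_gt0 D))).
  rewrite -[X in _ <= _ * X](expectation_expR_dotc ph) -expectationZ; last first.
    exact: expR_dotc_integrable.
  apply: ler_expectation => //.
  - by apply: integrable_wrtD => //; exact: dotc_integrable.
  - exact/integrable_wrtZ/expR_dotc_integrable.
  - move=> x; rewrite -expRN -expRD.
    by have := expR_ge1Dx (- D + dotc h (statistics c x)); lra.
rewrite expectationD//; last exact: dotc_integrable.
by rewrite expectation_cst// expectation_dotc; lra.
Qed.

(** Taking means in [expR_dotc_le] bounds exp(psi(th + h) - psi(th)); the tangent
inequality 1 + y <= exp(y) then removes the exponential on the left. *)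
Lemma log_partition_le h : n%:R * `|h| <= e / 2 ->
  probability_density (ef_density c (th + h)) ->
  log_partition c (th + h) - log_partition c th <=
  dotc h (mean_statistics c (ef_density c th)) +
  16 / e ^+ 2 * (n%:R * `|h|) ^+ 2 *
    expectation (ef_density c th) (fun x => exp_majorant e (statistics c x)).
Proof.
move=> he ph; set D := log_partition c (th + h) - _.
have i1 := integrable_wrt_cst p_density 1.
have ih := dotc_integrable h.
rewrite -expectation_dotc -expectationZ// -(lerD2l 1).
apply: le_trans (expR_ge1Dx _) _.
rewrite -(expectation_expR_dotc ph) -[X in X + _](expectation_cst p_density).
have iM := integrable_wrtZ (16 / e ^+ 2 * (n%:R * `|h|) ^+ 2) majorant_integrable.
rewrite addrA -!expectationD//; last exact: integrable_wrtD.
apply: ler_expectation => //.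
- exact: expR_dotc_integrable.
- by apply: integrable_wrtD => //; exact: integrable_wrtD.
- by move=> x; exact: expR_dotc_le.
Qed.

Lemma centered_integrable2 i j k l :
  integrable_wrt (ef_density c th) (fun x => (c i x - k) * (c j x - l)).
Proof.
have -> : (fun x => (c i x - k) * (c j x - l)) =
    (fun x => c i x * c j x + (- l * c i x + (- k * c j x + k * l))).
  by apply/funext => x; ring.
apply: integrable_wrtD; first exact: statistics_integrable2.
apply: integrable_wrtD; first exact/integrable_wrtZ/statistics_integrable.
apply: integrable_wrtD; first exact/integrable_wrtZ/statistics_integrable.
exact: integrable_wrt_cst.
Qed.

(** The Fisher matrix applied to w lists the covariances of the statistics with
the centered combination <c - m, w>. *)
Lemma fisher_ker w :
  (forall x, dotc (statistics c x - mean_statistics c (ef_density c th)) w = 0) ->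
  fisher c th *m w = 0.
Proof.
move=> w0; apply/colP => i; rewrite !mxE.
set p := ef_density c th in w0 *; set m := fun k => expectation p (c k).
transitivity (expectation p
    (fun x => \sum_j w j 0 * ((c i x - m i) * (c j x - m j)))).
  rewrite expectation_sum => [|j]; last first.
    exact/integrable_wrtZ/centered_integrable2.
  apply: eq_bigr => j _; rewrite mxE mulrC expectationZ//.
  exact: centered_integrable2.
rewrite -[RHS](expectation0 p); apply: eq_expectation => x /=.
transitivity ((c i x - m i) * dotc (statistics c x - mean_statistics c p) w);
  last by rewrite w0 mulr0.
rewrite dotcE mulr_sumr; apply: eq_bigr => j _; rewrite !mxE -/(m j); ring.
Qed.

End moments.

End exponential_family_theory.

(** * Derivatives along an interval *)

Section derivative_in_interval.
Variables (R : realType) (J : set R) (t : R).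

(** An interval that is not a point contains points arbitrarily close to t and
different from t, on the side of any other of its points. *)
Lemma derivative_in_proper_filter :
  is_interval J -> (exists s s', [/\ J s, J s' & s < s']) -> J t ->
  ProperFilter (within [set h | J (t + h)] (0 : R)^').
Proof.
move=> iJ [s [s' [Js Js' ss']]] Jt; apply: Build_ProperFilter => -[e /= e0 eF].
have [u Ju ut] : exists2 u, J u & u != t.
  by have [st|] := eqVneq s t; [exists s'; rewrite // -st gt_eqF|exists s].
have d0 : 0 < `|u - t| by rewrite normr_gt0 subr_eq0.
(* The point t + k (u - t) lies between t and u, within e of t. *)
pose k := Num.min 1 (e / (2 * `|u - t|)).
have k0 : 0 < k by rewrite lt_min ltr01 divr_gt0// mulr_gt0.
have k1 : k <= 1 by rewrite ge_min lexx.
have ke : k * `|u - t| < e.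
  apply: (@le_lt_trans _ _ (e / (2 * `|u - t|) * `|u - t|)).
    by rewrite ler_wpM2r// ge_min lexx orbT.
  by rewrite invfM mulrA -mulrA mulVf ?gt_eqF// mulr1; lra.
apply: (eF (k * (u - t))) => /=.
- by rewrite sub0r normrN normrM gtr0_norm.
- by apply: mulf_neq0; [exact: lt0r_neq0|rewrite subr_eq0].
- have [ltu|leu] := ltP t u; [apply: (iJ t u)|apply: (iJ u t)] => //.
    by apply/andP; split; nra.
  by apply/andP; split; nra.
Qed.

Lemma has_derivative_in_unique (u : R -> R) (v v' : R) :
  is_interval J -> (exists s s', [/\ J s, J s' & s < s']) -> J t ->
  has_derivative_in J u t v -> has_derivative_in J u t v' -> v = v'.
Proof.
move=> iJ nJ Jt; have FF := derivative_in_proper_filter iJ nJ Jt.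
exact: cvg_unique.
Qed.

(** Chain rule for an outer function known only through a first-order expansion
at th t with quadratic remainder, required only along the curve.  Divided by h,
the remainder is at most C |th (t + h) - th t| times the norm of the difference
quotient, which tends to 0 times |d|. *)
Lemma has_derivative_in_comp (V : normedModType R) (G L : V -> R)
    (th : R -> V) (d : V) (C r : R) :
  J t -> 0 < r -> (forall k v, L (k *: v) = k * L v) -> continuous L ->
  (forall s, J s -> `|th s - th t| <= r ->
     `|G (th s) - G (th t) - L (th s - th t)| <= C * `|th s - th t| ^+ 2) ->
  has_derivative_in J th t d ->
  has_derivative_in J (fun s => G (th s)) t (L d).
Proof.
move=> Jt r0 LZ cL GL thd; rewrite /has_derivative_in.
set F := within _ _; pose q h := h^-1 *: (th (t + h) - th t).
have qd : q h @[h --> F] --> d by exact: thd.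
have FF : Filter F by apply: within_filter.
have h0 : h @[h --> F] --> (0 : R).
  by apply: cvg_within_filter; exact: nbhs_dnbhs.
have Fh : \forall h \near F, h != 0 /\ J (t + h).
  apply: filterI; last exact: withinT.
  suff : \forall h \near (0 : R)^', J (t + h) -> h != 0 by [].
  by apply: filterS (nbhs_dnbhs_neq (0 : R)) => h.
have thq h : h != 0 -> th (t + h) - th t = h *: q h.
  by move=> hn0; rewrite scalerA divff// scale1r.
have dth0 : th (t + h) - th t @[h --> F] --> (0 : V).
  rewrite -(scale0r d); apply: cvg_trans (cvgZ h0 qd).
  by apply: near_eq_cvg; apply: filterS Fh => h [hn0 _]; rewrite thq.
pose rho h := h^-1 * (G (th (t + h)) - G (th t) - L (th (t + h) - th t)).
have rho0 : rho h @[h --> F] --> 0.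
  pose B h := C * `|th (t + h) - th t| * `|q h|.
  have B0 : B h @[h --> F] --> 0.
    have C0 : C * `|th (t + h) - th t| @[h --> F] --> C * `|0 : V|.
      by apply: cvgMl_tmp; exact: cvg_norm.
    by have := cvgM C0 (cvg_norm qd); rewrite normr0 mulr0 mul0r; apply.
  have NB0 : - B h @[h --> F] --> 0 by rewrite -oppr0; exact: cvgN.
  apply: squeeze_cvgr NB0 B0.
  have Fr : \forall h \near F, `|th (t + h) - th t| <= r.
    move/cvgr0_norm_le : dth0; exact.
  apply: filterS2 Fh Fr => h [hn0 Jh] hr.
  rewrite -ler_norml normrM.
  apply: (@le_trans _ _ (`|h^-1| * (C * `|th (t + h) - th t| ^+ 2))).
    by rewrite ler_wpM2l// GL.
  rewrite /B /q normrZ; lra.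
rewrite -[L d]addr0; apply: cvg_trans (cvgD (cvg_comp _ _ qd (cL d)) rho0).
apply: near_eq_cvg; apply: filterS Fh => h [hn0 _] /=.
transitivity (L (q h) + rho h) => //; rewrite /rho LZ -mulrDr.
by rewrite addrC subrK.
Qed.

End derivative_in_interval.

Lemma dotc_continuous (R : realType) (n : nat) (w : 'cV[R]_n) :
  continuous (dotc w).
Proof.
have -> : dotc w = (fun v => \sum_i w i 0 * v i 0).
  by apply/funext => v; exact: dotcE.
apply: continuous_big => [|i _ v]; first exact: add_continuous.
by apply: cvgMl_tmp; [exact: (nbhs_filter v)|exact: coord_continuous].
Qed.

(** * The projected Fokker-Planck field *)

(** The factor p of the mean cancels the denominator of the field.  The field thus
has mean 0, so that centering c_i does not matter, and duality turns the mean of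
its product with c_i into that of L c_i. *)
Lemma covariance_fokker_planck (R : realType) (N n : nat)
    (f : 'rV[R]_N -> 'rV[R]_N) (a : 'rV[R]_N -> 'M[R]_N)
    (c : 'I_n -> 'rV[R]_N -> R) (p : 'rV[R]_N -> R) i :
  (forall x, 0 < p x) -> generator_duality f a c p ->
  covariance p (fokker_planck_field f a p) (c i) =
  expectation p (generator f a (c i)).
Proof.
move=> p0 [iA A0 /(_ i)[icA iL cAL]].
have UpE x : fokker_planck_field f a p x * p x = generator_adj f a p x.
  by rewrite divfK// gt_eqF.
have iU : integrable_wrt p (fokker_planck_field f a p).
  by apply: eq_integrable iA => // x _; rewrite UpE.
have icU : integrable_wrt p (fun x => c i x * fokker_planck_field f a p x).
  by apply: eq_integrable icA => // x _; rewrite -mulrA UpE.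
have U0 : expectation p (fokker_planck_field f a p) = 0.
  by rewrite -[RHS]A0; apply: eq_Rintegral => x _; exact: UpE.
rewrite /Defs.covariance U0; set m := expectation p (c i).
transitivity (expectation p (fun x => c i x * fokker_planck_field f a p x
    + - m * fokker_planck_field f a p x)).
  by apply: eq_expectation => x; ring.
rewrite expectationD//; last exact: integrable_wrtZ.
rewrite expectationZ// U0 mulr0 addr0.
transitivity (\int[lebesgue_rV R N]_x (c i x * generator_adj f a p x)).
  by apply: eq_Rintegral => x _; rewrite -mulrA UpE.
by rewrite cAL; apply: eq_Rintegral => x _; rewrite mulrC.
Qed.

Lemma tangent_projectionE (R : realType) (N n : nat)
    (c : 'I_n -> 'rV[R]_N -> R) (th b : 'cV[R]_n) (U : 'rV[R]_N -> R) x :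
  (forall i, covariance (ef_density c th) U (c i) = b i 0) ->
  tangent_projection c th U x =
  (b^T *m invmx (fisher c th) *m
    (statistics c x - mean_statistics c (ef_density c th))) 0 0.
Proof.
move=> Ub; rewrite /tangent_projection mxE exchange_big/=; apply: eq_bigr => j _.
rewrite !mxE mulr_suml; apply: eq_bigr => i _; rewrite Ub mxE; ring.
Qed.

Lemma invmx_fisher_sym (R : realType) (N n : nat)
    (c : 'I_n -> 'rV[R]_N -> R) (th : 'cV[R]_n) :
  (invmx (fisher c th))^T = invmx (fisher c th).
Proof.
rewrite trmx_inv; congr invmx; apply/matrixP => i j; rewrite !mxE.
by apply: eq_expectation => x; rewrite mulrC.
Qed.

(** * The projected evolution *)

(** The term <th, c(x)> being linear in th, the remainder of the first-order
expansion of the log density is that of - psi; it does not depend on x. *)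
Lemma ln_ef_density_remainder (R : realType) (N n : nat)
    (c : 'I_n -> 'rV[R]_N -> R) (th h m : 'cV[R]_n) x :
  ln (ef_density c (th + h) x) - ln (ef_density c th x) -
    dotc (statistics c x - m) h =
  - (log_partition c (th + h) - log_partition c th - dotc h m).
Proof.
have -> : dotc (statistics c x - m) h = dotc h (statistics c x) - dotc h m.
  by rewrite dotcDl -scaleN1r dotcZl mulN1r !(dotcC h).
have shift (g g' v' v u w k l : R) : g' = v' - l -> g = v - k -> v' = v + u ->
    g' - g - (u - w) = - (l - k - w).
  by move=> -> -> ->; ring.
exact: (shift _ _ _ _ _ _ _ _ (ln_ef_density c (th + h) x)
  (ln_ef_density c th x) (dotcDl th h _)).
Qed.

(** With L = <c(x) - m, .>, the two bounds on psi give the quadratic remainder that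
the chain rule asks for. *)
Lemma ln_ef_density_derivative (R : realType) (N n : nat)
    (c : 'I_n -> 'rV[R]_N -> R) (Theta : set 'cV[R]_n) (J : set R)
    (theta : R -> 'cV[R]_n) (t : R) (d : 'cV[R]_n) x :
  (forall i, measurable_fun setT (c i : borel_rV R N -> R)) ->
  open Theta ->
  (forall th, Theta th -> probability_density (ef_density c th)) ->
  (forall s, J s -> Theta (theta s)) -> J t ->
  has_derivative_in J theta t d ->
  has_derivative_in J (fun s => ln (ef_density c (theta s) x)) t
    (dotc (statistics c x - mean_statistics c (ef_density c (theta t))) d).
Proof.
move=> mc oT dT JT Jt thd; set th := theta t.
have [e e0 ie] := exp_majorant_integrable oT (JT _ Jt) dT.
pose E := expectation (ef_density c th)
  (fun y => exp_majorant e (statistics c y)).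
(* The successor keeps the radius meaningful when n is 0. *)
pose r := e / 2 / n.+1%:R.
apply: (@has_derivative_in_comp _ _ _ _ (fun u => ln (ef_density c u x))
  (dotc _) theta d (16 / e ^+ 2 * n%:R ^+ 2 * E) r Jt).
- by rewrite !divr_gt0.
- by move=> k v; rewrite dotcC dotcZl dotcC.
- exact: dotc_continuous.
- move=> s Js; set h := theta s - th => hr.
  have sE : theta s = th + h by rewrite addrC subrK.
  have nh : n%:R * `|h| <= e / 2.
    apply: (@le_trans _ _ (n.+1%:R * r)); last by rewrite mulrC divfK.
    by rewrite ler_pM// ler_nat.
  have ph : probability_density (ef_density c (th + h)).
    by rewrite -sE; exact/dT/JT.
  have lo := log_partition_ge mc (dT _ (JT _ Jt)) e0 ie ph.
  have up := log_partition_le mc (dT _ (JT _ Jt)) e0 ie nh ph.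
  rewrite sE ln_ef_density_remainder normrN ger0_norm ?subr_ge0//.
  rewrite lerBlDl; apply: le_trans up _; rewrite lerD2l exprMn -/E.
  suff comm (k u w z : R) : k * (u * w) * z <= k * u * z * w by exact: comm.
  by rewrite mulrA mulrAC.
- exact: thd.
Qed.

(** The identity of functions of x determines d because the centered statistics
are linearly independent, which is what invertibility of the Fisher matrix
means. *)
Lemma explicit_parameter_equiv (R : realType) (N n : nat)
    (c : 'I_n -> 'rV[R]_N -> R) (th b d : 'cV[R]_n) (e : R) :
  (forall i, measurable_fun setT (c i : borel_rV R N -> R)) ->
  probability_density (ef_density c th) -> 0 < e ->
  integrable_wrt (ef_density c th) (fun x => exp_majorant e (statistics c x)) ->
  fisher c th \in unitmx ->
  (forall x, (statistics c x - mean_statistics c (ef_density c th))^T *m d =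
    b^T *m invmx (fisher c th) *m
      (statistics c x - mean_statistics c (ef_density c th))) <->
  d = invmx (fisher c th) *m b.
Proof.
move=> mc dp e0 ie gu; set g := fisher c th in gu *.
have rhsE u : b^T *m invmx g *m u = u^T *m (invmx g *m b).
  rewrite -[X in _ *m X *m _]invmx_fisher_sym -trmx_mul.
  by apply/matrixP => i j; rewrite !ord1; exact: dotcC.
split=> [eqd|-> x]; last by rewrite rhsE.
apply/eqP; rewrite -subr_eq0 -(mulKmx gu (d - _)).
rewrite (fisher_ker mc dp e0 ie) ?mulmx0// => x.
by rewrite /dotc mulmxBr -rhsE -eqd subrr mxE.
Qed.

Theorem proposition6p3 (R : realType) (N M n : nat)
  (d : measure_display) (Omega : measurableType d) (P : probability Omega R)
  (F : R -> set (set Omega)) (W : R -> Omega -> 'rV[R]_M)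
  (f : R -> 'rV[R]_N -> 'rV[R]_N) (sigma : R -> 'rV[R]_N -> 'M[R]_(N, M))
  (a : R -> 'rV[R]_N -> 'M[R]_N) (X : R -> Omega -> 'rV[R]_N)
  (p0 : 'rV[R]_N -> R) (nrm : 'M[R]_N -> R)
  (c : 'I_n -> 'rV[R]_N -> R) (Theta : set 'cV[R]_n)
  (J : set R) (theta dtheta : R -> 'cV[R]_n)
  (a_def : forall t x, a t x = sigma t x *m (sigma t x)^T)
  (F_filtration : is_filtration F)
  (W_brownian : is_brownian P F W)
  (X_solution : sde_solution P F W f sigma X)
  (X0_initial : initial_condition P (X 0) W p0)
  (fa_regular : regular_coefficients f a)
  (nrm_norm : is_matrix_norm nrm)
  (fa_non_explosion : non_explosion nrm f a)
  (c_C2 : forall i, C2 (c i))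
  (Theta_maximal : maximal_parameter_set c Theta)
  (fisher_invertible : forall th, Theta th -> fisher c th \in unitmx)
  (field_L2 : forall th t, Theta th -> 0 <= t ->
    let p := ef_density c th in
    (\int[lebesgue_rV R N]_x
      ((fokker_planck_field (f t) (a t) p x) ^+ 2 * p x)%:E < +oo)%E)
  (duality : forall th t, Theta th -> 0 <= t ->
    generator_duality (f t) (a t) c (ef_density c th))
  (J_interval : is_interval J)
  (J_ge0 : J `<=` `[0, +oo[)
  (J_nondegenerate : exists s t, [/\ J s, J t & s < t])
  (theta_in : forall t, J t -> Theta (theta t))
  (theta_derivative : forall t, J t -> has_derivative_in J theta t (dtheta t)) :
  forall t, J t ->
    let p := ef_density c (theta t) in
    let projected_equation := forall x : 'rV[R]_N,
      has_derivative_in J (fun s => ln (ef_density c (theta s) x)) t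
        (tangent_projection c (theta t)
           (fokker_planck_field (f t) (a t) p) x) in
    let explicit_equation := forall x : 'rV[R]_N,
      (statistics c x - mean_statistics c p)^T *m dtheta t =
      (mean_generator (f t) (a t) c p)^T *m invmx (fisher c (theta t)) *m
        (statistics c x - mean_statistics c p) in
    let parameter_equation :=
      dtheta t = invmx (fisher c (theta t)) *m mean_generator (f t) (a t) c p in
    (projected_equation <-> explicit_equation) /\
    (explicit_equation <-> parameter_equation).
Proof.
move=> t Jt p; have t0 : 0 <= t by have := J_ge0 _ Jt; rewrite /= in_itv/= andbT.
have [[oT _ dT] _] := Theta_maximal.
have mc i := C2_measurable (c_C2 i).
have [e e0 ie] := exp_majorant_integrable oT (theta_in _ Jt) dT.
have lnD x : has_derivative_in J (fun s => ln (ef_density c (theta s) x)) t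
    (dotc (statistics c x - mean_statistics c p) (dtheta t)).
  exact: ln_ef_density_derivative mc oT dT theta_in Jt (theta_derivative _ Jt).
have projE x : tangent_projection c (theta t)
    (fokker_planck_field (f t) (a t) p) x =
    ((mean_generator (f t) (a t) c p)^T *m invmx (fisher c (theta t)) *m
      (statistics c x - mean_statistics c p)) 0 0.
  apply: tangent_projectionE => i; rewrite mxE covariance_fokker_planck//.
    by move=> y; exact: ef_density_gt0.
  exact: duality _ _ (theta_in _ Jt) t0.
split; last first.
  apply: (explicit_parameter_equiv _ _ mc _ e0 ie).
    exact/dT/theta_in.
  exact/fisher_invertible/theta_in.
split=> eqx x.
  apply/matrixP => i j; rewrite !ord1 -projE.
  exact: has_derivative_in_unique J_interval J_nondegenerate Jt (lnD x) (eqx x).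
by rewrite projE -eqx; exact: lnD.
Qed.
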